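(* Let $R=\bigoplus_{\alpha\in\Gamma}R_{\alpha}$ be a graded integral domain. Then the following statements are equivalent: (1) $R$ is a graded Krull domain. (2) $\mathrm{NA}(R,v)$ is a Dedekind domain. (3) $\mathrm{NA}(R,v)$ is a PID.
   Context: $\Gamma$ is a commutative cancellative monoid (written additively) whose quotient group $\langle\Gamma\rangle$ is torsion-free. A graded integral domain $R=\bigoplus_{\alpha\in\Gamma}R_\alpha$ is an integral domain that is the direct sum of additive subgroups $R_\alpha$ with $R_\alpha R_\beta\subseteq R_{\alpha+\beta}$. $K$ is its quotient field, $H$ the set of nonzero homogeneous elements of $R$, $R_H$ the homogeneous quotient field. For $a\in R_H$, $C(a)$ is the $R$-submodule generated by the homogeneous components of $a$; for $f=f_0+\cdots+f_nX^n\in R[X]$, $A_f:=\sum_i C(f_i)$. For a nonzero $R$-submodule $E$ of $K$, $(R:E)=\{x\in K: xE\subseteq R\}$ and $E^v=(R:(R:E))$ (the $v$-operation). $N(v):=\{f\in R[X]: f\ne 0,\ A_f^v=R\}$ and $\mathrm{NA}(R,v):=R[X]_{N(v)}$. A graded Krull domain is a graded integral domain that is completely integrally closed with respect to homogeneous elements (i.e. if $x\in R_H$ is homogeneous and there is $0\ne c\in R$ with $cx^n\in R$ for all $n\ge1$, then $x\in R$) and satisfies the ascending chain condition on homogeneous $v$-ideals (homogeneous ideals $I$ with $I^v=I$). *)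

(* Defs.v *)
From HB Require Import structures.
From mathcomp Require Import all_boot all_order all_algebra.
From mathcomp Require Export fraction.
Set Implicit Arguments. Unset Strict Implicit. Unset Printing Implicit Defensive.
Import Order.TTheory GRing.Theory Num.Theory.
Local Open Scope ring_scope.

Section SubringOfField.
Variable F : fieldType.
Variable S : F -> Prop.

Definition is_subring : Prop :=
  [/\ S 0, S 1, (forall x y, S x -> S y -> S (x - y)) & (forall x y, S x -> S y -> S (x * y))].

Definition is_ideal (I : F -> Prop) : Prop :=
  [/\ (forall x, I x -> S x), I 0, (forall x y, I x -> I y -> I (x + y))
    & (forall s x, S s -> I x -> I (s * x))].

Definition is_prime_ideal (I : F -> Prop) : Prop :=
  [/\ is_ideal I, ~ I 1 & forall a b, S a -> S b -> I (a * b) -> I a \/ I b].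

Definition is_maximal_ideal (I : F -> Prop) : Prop :=
  [/\ is_ideal I, ~ I 1 &
     forall J, is_ideal J -> (forall x, I x -> J x) -> (forall x, J x -> I x) \/ J 1].

Definition is_noetherian : Prop :=
  forall I, is_ideal I -> exists (n : nat) (g : 'I_n -> F), (forall i, I (g i)) /\
    forall x, I x <-> exists r : 'I_n -> F, (forall i, S (r i)) /\ x = \sum_i r i * g i.

Definition is_integrally_closed : Prop :=
  forall x : F, (exists a b, [/\ S a, S b, b != 0 & x = a / b]) ->
    (exists p : {poly F}, [/\ p \is monic, (forall i, S p`_i) & root p x]) -> S x.

(* Dedekind domain: noetherian, integrally closed, every nonzero prime is maximal
   (fields count as Dedekind domains). *)
Definition is_Dedekind : Prop :=
  [/\ is_subring, is_noetherian, is_integrally_closed &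
     forall P, is_prime_ideal P -> (exists x, P x /\ x != 0) -> is_maximal_ideal P].

Definition is_PID : Prop :=
  is_subring /\ forall I, is_ideal I ->
    exists a, S a /\ forall x, I x <-> exists s, S s /\ x = s * a.
End SubringOfField.

Definition cancellative_torsionfree (G : nmodType) : Prop :=
  (forall a b c : G, a + b = a + c -> b = c) /\
  (* the quotient group <G> is torsion-free *)
  (forall (n : nat) (a b : G), (0 < n)%N -> a *+ n = b *+ n -> a = b).

Section Graded.
Variables (G : nmodType) (R : idomainType) (Rg : G -> R -> Prop).

Local Notation K := {fraction R}.
Local Notation "x %:F" := (@tofrac R x).

Definition is_grading : Prop :=
  [/\ (forall a, Rg a 0 /\ forall x y, Rg a x -> Rg a y -> Rg a (x - y)),
      (forall a b x y, Rg a x -> Rg b y -> Rg (a + b) (x * y)),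
      (forall x : R, exists (s : seq G) (f : G -> R),
          (forall a, Rg a (f a)) /\ x = \sum_(a <- s) f a) &
      (forall (s : seq G) (f : G -> R), uniq s -> (forall a, Rg a (f a)) ->
          \sum_(a <- s) f a = 0 -> forall a, a \in s -> f a = 0)].

Definition homogeneous (x : R) : Prop := exists a, Rg a x.

Definition is_comp (x : R) (a : G) (y : R) : Prop :=
  exists (s : seq G) (f : G -> R),
    [/\ uniq s, (forall b, Rg b (f b)), x = \sum_(b <- s) f b &
        y = if a \in s then f a else 0].

Definition Rspan (E : K -> Prop) (y : K) : Prop :=
  exists (n : nat) (g : 'I_n -> K) (r : 'I_n -> R),
    (forall i, E (g i)) /\ y = \sum_i (r i)%:F * g i.

Definition Ccont (x : R) : K -> Prop :=
  Rspan (fun y => exists a z, is_comp x a z /\ y = z%:F).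

(* A_f = sum_i C(f_i) *)
Definition Acont (f : {poly R}) : K -> Prop :=
  Rspan (fun y => exists i a z, is_comp f`_i a z /\ y = z%:F).

Definition colon (E : K -> Prop) (x : K) : Prop :=
  forall y, E y -> exists r : R, x * y = r%:F.

Definition vclos (E : K -> Prop) : K -> Prop := colon (colon E).

Definition Nv (f : {poly R}) : Prop :=
  f != 0 /\ forall x : K, vclos (Acont f) x <-> exists r : R, x = r%:F.

Definition NA (x : {fraction {poly R}}) : Prop :=
  exists g f : {poly R}, Nv f /\ x = (@tofrac _ g) / (@tofrac _ f).

Definition ideal_R (I : R -> Prop) : Prop :=
  [/\ I 0, (forall x y, I x -> I y -> I (x + y)) & (forall s x, I x -> I (s * x))].

Definition homogeneous_ideal (I : R -> Prop) : Prop :=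
  ideal_R I /\ forall x a y, I x -> is_comp x a y -> I y.

Definition v_ideal (I : R -> Prop) : Prop :=
  forall x : K, vclos (fun y => exists r, I r /\ y = r%:F) x <-> exists r, I r /\ x = r%:F.

Definition graded_Krull : Prop :=
  (* completely integrally closed w.r.t. homogeneous elements of R_H *)
  (forall x : K,
      (exists (a b : R) (al be : G), [/\ Rg al a, Rg be b, b != 0 & x = a%:F / b%:F]) ->
      (exists c : R, c != 0 /\ forall n, (0 < n)%N -> exists r : R, c%:F * x ^+ n = r%:F) ->
      exists r : R, x = r%:F) /\
  (forall I : nat -> R -> Prop,
      (forall n, homogeneous_ideal (I n) /\ v_ideal (I n)) ->
      (forall n x, I n x -> I n.+1 x) ->
      exists N, forall n, (N <= n)%N -> forall x, I n x <-> I N x).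
End Graded.

(* Main.v *)
(* Write c(f) for the ideal of R generated by the homogeneous components of the
   coefficients of f.  Only (1) => (3) => (2) => (1) has to be shown, and
   (3) => (2) holds for every subring of a field.

   (2) => (1).  An ideal I of R extends to the ideal { g / f : g in I[X], f in
   N(v) } of NA(R,v), and a homogeneous element of R in the extension of a
   homogeneous v-ideal I is already in I, so ascending chains are inherited
   from the noetherian ring NA(R,v).  Complete integral closedness is inherited
   in the same way.

   (1) => (3).  Given a nonzero ideal of NA(R,v), the chain condition yields a
   polynomial f in it whose content has maximal v-closure; since
   c(f + X^n g) = c(f) + c(g) for large n, every g in the ideal has
   c(g) contained in c(f)^v.  The same maximality argument applied to
   (R : c(f)) yields k over the homogeneous quotient field with
   c(k)^v = (R : c(f)).  Then fk and gk are in R[X] and, by Dedekind-Mertens and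
   complete integral closedness, c(fk)^v = R, so g / f = gk / (fk) is in
   NA(R,v) and f generates the ideal. *)
Require Import Defs.
From mathcomp Require Import all_boot all_order all_algebra.
From mathcomp Require Import boolp classical_sets.
From mathcomp Require Import ring.
Set Implicit Arguments. Unset Strict Implicit. Unset Printing Implicit Defensive.
Import GRing.Theory.
Local Open Scope ring_scope.

(** * Total orders on cancellative torsion-free monoids *)

Section Orderable.
Variable M : nmodType.
Hypothesis hM : cancellative_torsionfree M.

(** Translation is an equivalence because [M] has no subtraction. The last clause, purity, keeps the
    extension step below antisymmetric. *)
Definition pure_order (le : M -> M -> Prop) : Prop :=
  [/\ forall x, le x x,
      forall x y, le x y -> le y x -> x = y,
      forall x y z, le x y -> le y z -> le x z,
      forall x y z, le (x + z) (y + z) <-> le x y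
    & forall n x y, (0 < n)%N -> le (x *+ n) (y *+ n) -> le x y].

Lemma pure_orderD le x y z t :
  pure_order le -> le x y -> le z t -> le (x + z) (y + t).
Proof.
case=> _ _ tr tl _ xy zt; apply: (tr _ (y + z)); first by apply/tl.
by rewrite ![y + _]addrC; apply/tl.
Qed.

Lemma pure_orderMn le x y n : pure_order le -> le x y -> le (x *+ n) (y *+ n).
Proof.
move=> ole xy; elim: n => [|n IH]; first by case: ole.
by rewrite !mulrSr; apply: pure_orderD.
Qed.

(** The pure order generated by [le] and [a] below [b]: in the quotient group, a positive multiple
    of [y - x] is at least [n] times [b - a]. *)
Lemma extend_pure_order le a b : pure_order le -> ~ le b a ->
  pure_order (fun x y => exists k n, (0 < k)%N /\ le (x *+ k + b *+ n) (y *+ k + a *+ n)).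
Proof.
move=> ole nba; have [rf asym tr tl pu] := ole; split.
- by move=> x; exists 1%N, 0%N; split.
- move=> x y [k [n [k0 xy]]] [k' [n' [k'0 yx]]].
  have := pure_orderD ole (pure_orderMn k' ole xy) (pure_orderMn k ole yx).
  rewrite !mulrnDl -!mulrnA [(k' * k)%N]mulnC [(n' * k)%N]mulnC.
  rewrite [X in le X](AC (2*2) ((2*4)*(1*3))) [X in le _ X](AC (2*2) ((2*4)*(3*1))).
  rewrite /= -!mulrnDr => /tl.
  (* What is left is [b *+ N] below [a *+ N] for [N = n * k' + k * n']: a positive [N] gives
     [le b a] by purity, and [N = 0] leads back to [le]. *)
  case: (posnP (n * k' + k * n')) => [nn|nn]; last first.
    by move/(pu _ _ _ nn)/nba.
  move/eqP: nn; rewrite addn_eq0 !muln_eq0 (gtn_eqF k0) (gtn_eqF k'0) orbF /=.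
  case/andP=> /eqP n0 /eqP n'0 _; move: xy yx; rewrite n0 n'0 !mulr0n !addr0.
  by move=> /(pu _ _ _ k0) xy /(pu _ _ _ k'0); apply: asym.
- move=> x y z [k [n [k0 xy]]] [k' [n' [k'0 yz]]].
  exists (k * k')%N, (n * k' + n' * k)%N; split; first by rewrite muln_gt0 k0.
  have := pure_orderD ole (pure_orderMn k' ole xy) (pure_orderMn k ole yz).
  rewrite !mulrnDl -!mulrnA [(k' * k)%N]mulnC.
  rewrite [X in le X](AC (2*2) ((1*(2*4))*3)) [X in le _ X](AC (2*2) ((3*(2*4))*1)).
  by rewrite /= -!mulrnDr => /tl.
- move=> x y z; split=> -[k [n [k0 h]]]; exists k, n; split=> //; move: h.
    by rewrite !mulrnDl ![_ + z *+ _ + _]addrAC => /tl.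
  by rewrite !mulrnDl ![_ + z *+ _ + _]addrAC => h; apply/tl.
- move=> m x y m0 [k [n [k0 h]]]; exists (m * k)%N, n.
  by rewrite muln_gt0 m0 !mulrnA.
Qed.

(* Zorn's lemma applied to the pure orders on [M]: a maximal one is total. *)
Lemma total_pure_order :
  exists le, pure_order le /\ forall x y, le x y \/ le y x.
Proof.
have [canc tf] := hM.
(* With the diagonal added, the empty chain yields equality, a pure order by cancellation and
   torsion-freeness. *)
pose rel_of (A : set (M * M)) x y := x = y \/ A (x, y).
pose P : set (set (M * M)) := fun A => pure_order (rel_of A).
have P_eq A B : (forall x y, rel_of A x y <-> B x y) -> pure_order B -> P A.
  move=> e; rewrite /P; suff -> : rel_of A = B by [].
  by apply/funext => x; apply/funext => y; apply/propext.
have [|A [PA maxA]] := @Zorn_bigcup _ P.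
  move=> F FP totF.
  have up A x y : F A -> rel_of A x y -> rel_of (\bigcup_(X in F) X)%classic x y.
    by move=> FA [->|xy]; [left|right; exists A].
  have down x y : rel_of (\bigcup_(X in F) X)%classic x y ->
      x = y \/ exists2 A, F A & rel_of A x y.
    by case=> [->|[A FA xy]]; [left|right; exists A => //; right].
  have down2 x y z t : rel_of (\bigcup_(X in F) X)%classic x y ->
      rel_of (\bigcup_(X in F) X)%classic z t ->
      (x = y \/ z = t) \/ exists2 A, F A & rel_of A x y /\ rel_of A z t.
    case/down=> [->|[A FA xy]]; first by left; left.
    case/down=> [->|[B FB zt]]; first by left; right.
    right; case: (totF _ _ FA FB) => AB; [exists B => //|exists A => //].
      by split=> //; case: xy => [->|xy]; [left|right; apply: AB].
    by split=> //; case: zt => [->|zt]; [left|right; apply: AB].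
  split.
  - by left.
  - move=> x y xy yx; case: (down2 _ _ _ _ xy yx) => [[]//|[A /FP [_ asym _ _ _] []]].
    exact: asym.
  - move=> x y z xy yz; case: (down2 _ _ _ _ xy yz) => [[e|e]|[A FA []]].
    + by rewrite e.
    + by rewrite -e.
    have [_ _ tr _ _] := FP _ FA.
    by move=> h1 h2; apply: up FA _; apply: tr h1 h2.
  - move=> x y z; split.
      case/down=> [|[A FA]].
        by rewrite ![_ + z]addrC => /canc ->; left.
      have [_ _ _ tl _] := FP _ FA.
      by move/tl; apply: up.
    case/down=> [->|[A FA h]]; first by left.
    have [_ _ _ tl _] := FP _ FA.
    by apply: up FA _; apply/tl.
  - move=> n x y n0; case/down=> [/(tf _ _ _ n0) ->|[A FA]]; first by left.
    have [_ _ _ _ pu] := FP _ FA.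
    by move/(pu _ _ _ n0); apply: up.
exists (rel_of A); split=> // a b; apply: contrapT => nab.
have nle : ~ rel_of A a b by move=> h; apply: nab; left.
have nge : ~ rel_of A b a by move=> h; apply: nab; right.
have ext := extend_pure_order PA nge.
set le' := (fun x y => _) in ext.
have sub x y : rel_of A x y -> le' x y.
  by move=> h; exists 1%N, 0%N; split=> //; rewrite !mulr0n !addr0 !mulr1n.
apply: (maxA (fun p => le' p.1 p.2)); last first.
  apply: P_eq ext => x y; split; last by right.
  by case=> [->|//]; apply: sub; left.
split=> [[x y] xy|h]; first by apply: sub; right.
apply: nle; right; apply: (h (a, b)); exists 1%N, 1%N.
by rewrite /= addrC; split=> //; left.
Qed.
End Orderable.

(** * Dedekind-Mertens for formal sums of terms *)

Section Content.
Variables (M : nmodType) (A : comNzRingType) (le : M -> M -> Prop).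
Hypotheses (ole : pure_order le) (tle : forall x y, le x y \/ le y x).

(** Lists of pairs (degree, coefficient) stand for sums of monomials; this is a coefficient of their
    product. *)
Definition conv (s t : seq (M * A)) (d : M) : A :=
  \sum_(p <- s) \sum_(q <- t | p.1 + q.1 == d) p.2 * q.2.

Definition key_gt (p q : M * A) : bool := ~~ `[< le p.1 q.1 >].

Definition additive_pred (L : A -> Prop) : Prop :=
  L 0 /\ forall x y, L x -> L y -> L (x - y).

Lemma additive_predD L x y : additive_pred L -> L x -> L y -> L (x + y).
Proof.
by move=> [L0 LB] Lx Ly; rewrite -[y]opprK -[- y]sub0r; apply: LB (Lx) (LB _ _ L0 Ly).
Qed.

Lemma additive_pred_sum L (I : eqType) (r : seq I) (P : pred I) (F : I -> A) :
  additive_pred L -> (forall i, i \in r -> P i -> L (F i)) ->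
  L (\sum_(i <- r | P i) F i).
Proof.
move=> aL; rewrite big_seq_cond => LF; apply: (big_ind L).
- by case: aL.
- by move=> x y; apply: additive_predD.
- by move=> i /andP[]; apply: LF.
Qed.

Lemma conv_consl p s t d :
  conv (p :: s) t d = \sum_(q <- t | p.1 + q.1 == d) p.2 * q.2 + conv s t d.
Proof. by rewrite /conv big_cons. Qed.

Lemma conv_consr s q t d :
  conv s (q :: t) d = \sum_(p <- s | p.1 + q.1 == d) p.2 * q.2 + conv s t d.
Proof.
rewrite /conv [in RHS]big_mkcond -big_split; apply: eq_bigr => p _.
by rewrite big_cons; case: ifP; rewrite //= add0r.
Qed.

Lemma key_gt_neq p q u v :
  key_gt p q -> le v u -> q.1 + v != p.1 + u.
Proof.
have [rf asym tr tl _] := ole.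
move=> /asboolPn npq vu; apply/eqP => e; apply: npq.
have [//|qp] := tle p.1 q.1.
apply/(tl _ _ u); rewrite -e.
by apply: pure_orderD ole _ vu.
Qed.

(** No other pair of terms reaches the sum of the two leading degrees. *)
Lemma conv_top p s q t :
  all (key_gt p) s -> all (key_gt q) t ->
  conv (p :: s) (q :: t) (p.1 + q.1) = p.2 * q.2.
Proof.
have [rf asym tr tl _] := ole.
have gt_le x y : key_gt x y -> le y.1 x.1.
  by move=> /asboolPn; case: (tle x.1 y.1).
move=> /allP gp /allP gq; rewrite conv_consl big_cons eqxx /=.
rewrite big_seq_cond big1 ?addr0; last first.
  move=> r /andP[/gq gr /eqP e]; have := key_gt_neq gr (rf p.1).
  by rewrite addrC e addrC eqxx.
rewrite /conv big_seq big1 ?addr0 // => r /gp gr.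
rewrite big_seq_cond big1 // => r' /andP[r't e].
have := @key_gt_neq _ _ q.1 r'.1 gr; rewrite (eqP e) eqxx => absurd.
by have /absurd: le r'.1 q.1 by move: r't; rewrite in_cons => /predU1P[->//|/gq/gt_le].
Qed.

(* Residual form of the Dedekind-Mertens inclusion
   [c(f)^(m+1) c(g) <= c(f)^m c(fg)] for [g] with at most [m+1] terms: stating
   it through all additive subgroups [L] avoids arithmetic of ideals.  The
   induction removes the top term of [f] or of [g]. *)
Lemma dedekind_mertens s t m L :
  pairwise key_gt s -> pairwise key_gt t -> (size t <= m.+1)%N ->
  additive_pred L ->
  (forall u d, size u = m -> {subset u <= map snd s} ->
     L (\prod_(x <- u) x * conv s t d)) ->
  forall u q, size u = m.+1 -> {subset u <= map snd s} -> q \in t ->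
  L (\prod_(x <- u) x * q.2).
Proof.
move: {2}(size s + size t)%N (leqnn (size s + size t)) => n.
elim: n s t m L => [|n IH] s t m L.
  by rewrite leqn0 addn_eq0 !size_eq0 => /andP[_ /eqP ->].
case: t => [//|q t]; case: s => [|p s].
  move=> _ _ _ _ _ _ [//|x u] r _ sub.
  by have := sub x (mem_head _ _); rewrite in_nil.
move=> /= le_n /andP[gp gs] /andP[gq gt] le_m aL HL.
have [L0 LB] := aL.
have top := conv_top gp gq.
have stepA u : size u = m -> {subset u <= map snd (p :: s)} ->
    L (\prod_(x <- u) x * (p.2 * q.2)) by move=> su sub; rewrite -top; apply: HL.
have stepB u r : size u = m -> {subset u <= map snd (p :: s)} -> r \in q :: t ->
    L (\prod_(x <- u) x * (p.2 * r.2)).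
  move=> su sub; rewrite in_cons => /predU1P[->|rt]; first exact: stepA.
  case: m le_m HL stepA su => [|m] le_m HL stepA su.
    by move: le_m rt; rewrite ltnS leqn0 size_eq0 => /eqP ->.
  (* Dropping [q] lowers [m] by one; the spare factor [p.2] is absorbed by the residual [L'] of
     [L]. *)
  pose L' z := L (p.2 * z).
  suff : L' (\prod_(x <- u) x * r.2) by rewrite /L' mulrCA.
  apply: (IH (p :: s) t m L') => //=; first by rewrite -ltnS -addnS.
  - by apply/andP.
  - by split; [rewrite /L' mulr0 | move=> x y; rewrite /L' mulrBr; apply: LB].
  move=> v d sv vsub; rewrite /L'.
  have pv : {subset p.2 :: v <= map snd (p :: s)}.
    by move=> x; rewrite in_cons => /predU1P[->|/vsub//]; rewrite mem_head.
  have -> : conv (p :: s) t d = conv (p :: s) (q :: t) d -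
      \sum_(p' <- p :: s | p'.1 + q.1 == d) p'.2 * q.2 by rewrite conv_consr addrC addKr.
  rewrite mulrBr mulrBr; apply: LB.
    by have := HL (p.2 :: v) d; rewrite /= big_cons mulrA; apply=> //; rewrite sv.
  rewrite mulrA big_distrr /=; apply: additive_pred_sum => // p' p's _.
  (* Swapping [p.2] and [p'.2] turns the correction terms, all multiples of [q.2], into instances of
     [stepA]. *)
  have -> : p.2 * \prod_(x <- v) x * (p'.2 * q.2) =
     \prod_(x <- p'.2 :: v) x * (p.2 * q.2) by rewrite big_cons; ring.
  apply: stepA; first by rewrite /= sv.
  by move=> x; rewrite in_cons => /predU1P[->|/vsub//]; apply: map_f.
move=> u r su sub rt.
(* If [p.2] is a factor, [stepB] concludes; otherwise all factors come from [s], and dropping [p]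
   costs only terms covered by [stepB]. *)
have [pu|pu] := boolP (p.2 \in u).
  rewrite (perm_big _ (perm_to_rem pu)) big_cons /= -mulrA mulrCA.
  apply: stepB => //; first by rewrite size_rem // su.
  by move=> x /mem_rem/sub.
apply: (IH s (q :: t) m L) => //=; first by apply/andP.
  move=> v d sv vsub.
  have vsub' : {subset v <= map snd (p :: s)}.
    by move=> x /vsub; rewrite /= in_cons orbC => ->.
  have -> : conv s (q :: t) d = conv (p :: s) (q :: t) d -
      \sum_(q' <- q :: t | p.1 + q'.1 == d) p.2 * q'.2 by rewrite conv_consl addrC addKr.
  rewrite mulrBr; apply: LB; first exact: HL.
  by rewrite big_distrr /=; apply: additive_pred_sum => // q' q't _; apply: stepB.
move=> x xu; have := sub x xu; rewrite /= in_cons => /predU1P[xp|//].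
by move: pu; rewrite -xp xu.
Qed.
End Content.

(** * Principal and noetherian subrings of a field *)

Section PrincipalSubring.
Variables (F : fieldType) (S : F -> Prop).

Lemma subring_pred : is_subring S ->
  [/\ S 0, S 1, forall x y, S x -> S y -> S (x + y), forall x, S x -> S (- x)
    & forall x y, S x -> S y -> S (x * y)].
Proof.
move=> [S0 S1 SB SM]; have SN x : S x -> S (- x) by rewrite -sub0r; apply: SB.
by split=> // x y Sx Sy; rewrite -[y]opprK; apply: SB => //; apply: SN.
Qed.

Lemma subring_predX x n : is_subring S -> S x -> S (x ^+ n).
Proof.
case/subring_pred=> _ S1 _ _ SM Sx.
by elim: n => [|n IH]; rewrite ?expr0 ?exprS //; apply: SM.
Qed.

(** For integral closedness, the [y] with every [x ^+ k * y] in [S] form an ideal stable under [x].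
    It contains a power of the denominator [b], so its generator [d] is nonzero, and
    [x * d = s' * d] gives [x] in [S]. *)
Lemma PID_Dedekind : is_PID S -> is_Dedekind S.
Proof.
move=> [rS pS]; have [S0 S1 SD SN SM] := subring_pred rS.
split=> //.
- move=> I /pS[a [Sa Ia]]; exists 1%N, (fun=> a); split=> [_|x].
    by apply/Ia; exists 1; rewrite mul1r.
  split=> [/Ia[s [Ss ->]]|[r [Sr ->]]].
    by exists (fun=> s); rewrite big_ord1.
  by apply/Ia; rewrite big_ord1; exists (r ord0).
- move=> x [a [b [Sa Sb b0 xE]]] [p [pm Sp px]].
  pose I y := forall k, S (x ^+ k * y).
  have [|d [Sd Id]] := pS I.
    split=> [y /(_ 0%N)|k|y z Iy Iz k|s y Ss Iy k].
    - by rewrite mul1r.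
    - by rewrite mulr0.
    - by rewrite mulrDr; apply: SD.
    - by rewrite mulrCA; apply: SM.
  have Ib : I (b ^+ size p).
    (* Up to exponent [size p] the power of [b] clears denominators; beyond it, [p] reduces [x ^+ k]
       to lower powers. *)
    elim/ltn_ind => k IH.
    have [kp|pk] := leqP k (size p).
      rewrite xE expr_div_n -mulrA [_^-1 * _]mulrC -expfB_cond; last first.
        by rewrite (negPf b0).
      by apply: SM; apply: subring_predX.
    have p_gt0 : (0 < size p)%N by rewrite lt0n size_poly_eq0 monic_neq0.
    have xp : x ^+ (size p).-1 = - \sum_(i < (size p).-1) p`_i * x ^+ i.
      apply/eqP; rewrite -addr_eq0 addrC; move: px; rewrite /root.
      rewrite (horner_coef_wide _ (leqSpred _)) big_ord_recr /=.
      by rewrite -[p`_(size p).-1]/(lead_coef p) (monicP pm) mul1r.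
    have pk' : ((size p).-1 <= k)%N by apply: leq_trans (leq_pred _) (ltnW pk).
    rewrite -(subnK pk') exprD xp mulrN mulNr big_distrr big_distrl /=.
    apply: SN; apply: (big_ind S) => // i _.
    rewrite mulrCA -mulrA -mulrA; apply: SM => //.
    rewrite mulrA -exprD; apply: IH.
    by rewrite -[X in (_ < X)%N](subnK pk') ltn_add2l.
  have [s [Ss bE]] := (Id _).1 Ib.
  have d0 : d != 0.
    by apply: contraNneq b0 => d0; move/eqP: bE; rewrite d0 mulr0 expf_eq0 => /andP[].
  have [|s' [Ss' xd]] := (Id (x * d)).1.
    move=> k; rewrite mulrA -exprSr.
    by apply: (Id d).2; exists 1; rewrite mul1r.
  by rewrite (mulIf d0 xd).
- move=> P [idP P1 prP] [z [Pz z0]]; have [p [Sp Pp]] := pS P idP.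
  have Ppp : P p by apply/Pp; exists 1; rewrite mul1r.
  have p0 : p != 0.
    by apply: contraNneq z0 => p0; have /Pp[s [_ ->]] := Pz; rewrite p0 mulr0.
  split=> // J idJ PJ; have [j [Sj Jj]] := pS J idJ.
  have [s [Ss pE]] := (Jj p).1 (PJ _ Ppp).
  have [|||Ps|Pj] := prP s j => //; first by rewrite -pE.
    right; have [t [St sE]] := (Pp s).1 Ps.
    apply/Jj; exists t; split=> //; apply: (mulIf p0).
    by rewrite mul1r {1}pE sE mulrAC.
  have [_ _ _ PM] := idP.
  by left=> x /Jj[t [St ->]]; apply: PM.
Qed.

(* The ideals [(c, cx, ..., cx^n)] stabilise, so [c x^(n+1)] is a combination
   of the previous [c x^i], an equation of integral dependence for [x]. *)
Lemma Dedekind_completely_integrally_closed c x :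
  is_subring S -> is_noetherian S -> is_integrally_closed S ->
  (exists a b, [/\ S a, S b, b != 0 & x = a / b]) ->
  c != 0 -> (forall n, S (c * x ^+ n)) -> S x.
Proof.
move=> rS nS iS xab c0 Scx; have [S0 S1 SD SN SM] := subring_pred rS.
pose I y := exists p : {poly F}, (forall i, S p`_i) /\ y = c * p.[x].
have [|m [g [Ig gI]]] := nS I.
  split.
  - move=> _ [p [Sp ->]]; rewrite horner_coef big_distrr /=.
    by apply: (big_ind S) => // i _; rewrite mulrCA; apply: SM.
  - by exists 0; rewrite horner0 mulr0; split=> // i; rewrite coef0.
  - move=> _ _ [p [Sp ->]] [q [Sq ->]]; exists (p + q); rewrite hornerD mulrDr.
    by split=> // i; rewrite coefD; apply: SD.
  - move=> s _ Ss [p [Sp ->]]; exists (s *: p); rewrite hornerZ mulrCA.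
    by split=> // i; rewrite coefZ; apply: SM.
have [P gP] := choice Ig.
pose N := \max_i size (P i).
have [|r [Sr rE]] := (gI (c * x ^+ N)).1.
  exists 'X^N; rewrite hornerXn; split=> // i; rewrite coefXn.
  by case: eqP.
pose q := \sum_i r i *: P i.
have Sq i : S q`_i.
  rewrite coef_sum; apply: (big_ind S) => // k _; rewrite coefZ.
  by apply: SM => //; apply: (gP k).1.
have qx : q.[x] = x ^+ N.
  apply: (mulfI c0); rewrite rE horner_sum big_distrr /=.
  by apply: eq_bigr => i _; rewrite hornerZ mulrCA; congr (_ * _); rewrite (gP i).2.
have sq : (size q <= N)%N.
  apply: leq_trans (size_sum _ _ _) _; apply/bigmax_leqP => i _.
  by apply: leq_trans (size_scale_leq _ _) _; apply: leq_bigmax.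
apply: iS => //; exists ('X^N - q); split.
- by rewrite monicE lead_coefDl ?lead_coefXn // size_polyN size_polyXn.
- by move=> i; rewrite coefB coefXn; apply: SD; [case: eqP|apply: SN].
- by rewrite /root hornerD hornerN hornerXn qx subrr.
Qed.
End PrincipalSubring.

(** * Identities for fractions and shifted sums of polynomials *)

Lemma eqf_div_mul (F : fieldType) (a b r w : F) : b != 0 ->
  (a / b * r == w) = (a * r == b * w).
Proof. by move=> b0; rewrite mulrAC [b * w]mulrC (can2_eq (divfK b0) (mulfK b0)). Qed.

Lemma eqf_div_mul_div (F : fieldType) (a b c d w : F) : b != 0 -> d != 0 ->
  (a / b * (c / d) == w) = (a * c == b * d * w).
Proof. by move=> b0 d0; rewrite mulf_div -[_ / _]mulr1 eqf_div_mul ?mulf_neq0 // mulr1. Qed.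
Lemma coef_addXn (R : nzRingType) (f g : {poly R}) i :
  (f + 'X^(size f) * g)`_(size f + i) = g`_i.
Proof.
by rewrite coefD coefXnM nth_default ?leq_addr // add0r ltnNge leq_addr /= addKn.
Qed.

Lemma addXn_neq0 (R : nzRingType) (f g : {poly R}) :
  g != 0 -> f + 'X^(size f) * g != 0.
Proof.
by apply: contraNneq => e; rewrite -lead_coef_eq0 lead_coefE -(coef_addXn f) e coef0.
Qed.

(** * Homogeneous components in a graded domain *)

Section GradedDomain.
Variables (G : nmodType) (R : idomainType) (Rg : G -> R -> Prop).
Hypotheses (hG : cancellative_torsionfree G) (hR : is_grading Rg).

Local Notation K := {fraction R}.
Local Notation "x %:F" := (@tofrac _ x).

Lemma graded0 a : Rg a 0. Proof. by case: hR => /(_ a)[]. Qed.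

Lemma gradedB a x y : Rg a x -> Rg a y -> Rg a (x - y).
Proof. by case: hR => /(_ a)[_ h] _ _ _; apply: h. Qed.

Lemma gradedD a x y : Rg a x -> Rg a y -> Rg a (x + y).
Proof.
by move=> hx hy; rewrite -[y]opprK -[- y]sub0r; apply: gradedB (hx) (gradedB (graded0 a) hy).
Qed.

Lemma gradedM a b x y : Rg a x -> Rg b y -> Rg (a + b) (x * y).
Proof. by case: hR => _ h _ _; apply: h. Qed.

Lemma graded_sum a (I : eqType) (l : seq I) (P : pred I) (v : I -> R) :
  (forall i, i \in l -> P i -> Rg a (v i)) -> Rg a (\sum_(i <- l | P i) v i).
Proof.
move=> h; rewrite big_seq_cond; apply: (big_ind (Rg a)); first exact: graded0.
  by move=> x y; apply: gradedD.
by move=> i /andP[]; apply: h.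
Qed.

Lemma is_comp_graded x a y : is_comp Rg x a y -> Rg a y.
Proof. by case=> s [f [_ hf _ ->]]; case: ifP => _; [|apply: graded0]. Qed.

(** Both decompositions are extended by zero to a common support, where the independence clause of
    [is_grading] applies to their difference. *)
Lemma is_comp_unique x a y z : is_comp Rg x a y -> is_comp Rg x a z -> y = z.
Proof.
move=> [s [f [us hf xs ->]]] [t [g [ut hg xt ->]]].
pose r := undup (s ++ t).
pose h b := (if b \in s then f b else 0) - (if b \in t then g b else 0).
have hh b : Rg b (h b).
  by apply: gradedB; case: ifP => _ //; apply: graded0.
have extend (l : seq G) (k : G -> R) : uniq l -> {subset l <= r} ->
    \sum_(b <- r) (if b \in l then k b else 0) = \sum_(b <- l) k b.
  move=> ul lr; rewrite -big_mkcond -big_filter; apply: perm_big.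
  apply: uniq_perm => //; first by rewrite filter_uniq // undup_uniq.
  by move=> b; rewrite mem_filter; case: (boolP (b \in l)) => // /lr ->.
have h0 : \sum_(b <- r) h b = 0.
  rewrite sumrB !extend -?xs -?xt ?subrr // => b bl;
  by rewrite mem_undup mem_cat bl ?orbT.
have [ar|ar] := boolP (a \in r).
  by apply/eqP; rewrite -subr_eq0; case: hR => _ _ _ /(_ r h (undup_uniq _) hh h0 a ar) /eqP.
by move: ar; rewrite mem_undup mem_cat negb_or => /andP[/negPf -> /negPf ->].
Qed.

Lemma is_comp_sum (I : eqType) (l : seq I) (deg : I -> G) (v : I -> R) a :
  (forall i, i \in l -> Rg (deg i) (v i)) ->
  is_comp Rg (\sum_(i <- l) v i) a (\sum_(i <- l | deg i == a) v i).
Proof.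
move=> hv; pose f b := \sum_(i <- l | deg i == b) v i.
exists (undup (map deg l)), f; split.
- exact: undup_uniq.
- by move=> b; apply: graded_sum => i il /eqP <-; apply: hv.
- rewrite /f (exchange_big_dep xpredT) //= big_seq [RHS]big_seq.
  apply: eq_bigr => i il.
  under eq_bigl do rewrite eq_sym.
  rewrite -big_filter filter_pred1_uniq ?undup_uniq ?big_seq1 //.
  by rewrite mem_undup; apply: map_f.
case: ifPn => //; rewrite mem_undup => na; rewrite big_seq_cond big1 // => i.
by case/andP=> il /eqP ia; case/negP: na; rewrite -ia; apply: map_f.
Qed.

Lemma is_comp_exists x a : exists y, is_comp Rg x a y.
Proof.
case: hR => _ _ /(_ x)[s [f [hf ->]]] _.
by eexists; apply: (@is_comp_sum _ s id) => i _.
Qed.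

Lemma is_comp0 a : is_comp Rg 0 a 0.
Proof. by exists [::], (fun=> 0); split=> //; [move=> ?; apply: graded0|rewrite big_nil]. Qed.

Lemma comp_decomposition x : exists (s : seq G) (f : G -> R),
  [/\ uniq s, x = \sum_(a <- s) f a, forall a, a \in s -> is_comp Rg x a (f a)
    & forall a y, is_comp Rg x a y -> y != 0 -> a \in s /\ y = f a].
Proof.
(* The degree 0 is arbitrary: only the decomposition in the witness is kept. *)
have [_ [s [f [us hf xs _]]]] := is_comp_exists x 0.
exists s, f; split=> // [a as_|a y xy y0]; first by exists s, f; rewrite as_.
have : is_comp Rg x a (if a \in s then f a else 0) by exists s, f.
move=> /(is_comp_unique xy) yE; move: y0; rewrite yE.
by case: ifP; rewrite ?eqxx.
Qed.

Lemma comp_neq0 x : x != 0 -> exists a y, is_comp Rg x a y /\ y != 0.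
Proof.
move=> x0; have [s [f [_ xE cf _]]] := comp_decomposition x.
apply: contrapT => nex; case/eqP: x0; rewrite xE big_seq big1 // => a as_.
apply: contrapT => /eqP fa0; apply: nex.
by exists a, (f a); split=> //; apply: cf.
Qed.

(** By cancellation in [G], translation by [b] keeps distinct degrees apart, so no components
    merge. *)
Lemma is_comp_mulr x z a b y :
  is_comp Rg x a y -> Rg b z -> is_comp Rg (x * z) (a + b) (y * z).
Proof.
move=> [s [f [us hf -> ->]]] hz.
have := @is_comp_sum _ s (fun c => c + b) (fun c => f c * z) (a + b)
  (fun c _ => gradedM (hf c) hz).
rewrite -big_distrl /=; congr (is_comp Rg _ _ _).
rewrite -big_distrl /=; congr (_ * _).
under eq_bigl => c.
  rewrite (_ : (c + b == a + b) = (c == a)); last first.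
    by apply/eqP/eqP => [|->//]; rewrite ![_ + b]addrC => /hG.1.
  over.
rewrite -big_filter; case: ifPn => as_; first by rewrite filter_pred1_uniq ?big_seq1.
rewrite (_ : [seq _ <- s | _] = [::]) ?big_nil //.
by apply/eqP; rewrite -[_ == _]negbK -has_filter has_pred1.
Qed.

(** In degree [b + a] the left side has component [y * z] and the right side a multiple of [c]. This
    is why conductors of homogeneous elements are closed under taking components. *)
Lemma comp_dvd_cancel a z b y d c e u :
  Rg a z -> Rg e c -> is_comp Rg d b y -> d * z = c * u ->
  exists u', y * z = c * u'.
Proof.
move=> hz hc dy duE; have dz := is_comp_mulr dy hz; rewrite duE in dz.
have [t [g [_ uE hg _]]] := comp_decomposition u.
have hcg i : i \in t -> Rg (e + i) (c * g i).
  by move=> it; apply: gradedM hc (is_comp_graded (hg i it)).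
exists (\sum_(i <- t | e + i == b + a) g i).
apply: (is_comp_unique dz); rewrite uE !big_distrr /=.
exact: is_comp_sum.
Qed.

(** * Contents and their colons in the quotient field *)

Definition in_base (x : K) : Prop := exists r : R, x = r%:F.

Lemma in_base_subring : is_subring in_base.
Proof.
split.
- by exists 0; rewrite tofrac0.
- by exists 1; rewrite tofrac1.
- by move=> _ _ [r ->] [s ->]; exists (r - s); rewrite tofracB.
- by move=> _ _ [r ->] [s ->]; exists (r * s); rewrite tofracM.
Qed.

Lemma in_base_sum (I : eqType) (r : seq I) (P : pred I) (F : I -> K) :
  (forall i, i \in r -> P i -> in_base (F i)) -> in_base (\sum_(i <- r | P i) F i).
Proof.
have [b0 _ bD _ _] := subring_pred in_base_subring.
move=> h; rewrite big_seq_cond; apply: (big_ind in_base) => // i /andP[]; exact: h.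
Qed.

Lemma in_baseM x y : in_base x -> in_base y -> in_base (x * y).
Proof. by have [_ _ _ h] := in_base_subring; apply: h. Qed.

Lemma in_base_tofrac r : in_base r%:F. Proof. by exists r. Qed.

Definition content_elt (f : {poly R}) (z : R) : Prop :=
  exists i a, is_comp Rg f`_i a z.

Definition content_colon (f : {poly R}) (x : K) : Prop :=
  forall z, content_elt f z -> in_base (x * z%:F).

Lemma colon_Acont f x : colon (Acont Rg f) x <-> content_colon f x.
Proof.
split=> [cx z [i [a fz]]|cx _ [n [g [r [gE ->]]]]].
  apply: cx; exists 1%N, (fun=> z%:F), (fun=> 1); rewrite big_ord1 tofrac1 mul1r.
  by split=> // _; exists i, a, z.
rewrite big_distrr /=; apply: in_base_sum => k _ _.
have [i [a [z [fz ->]]]] := gE k; rewrite mulrCA; apply: in_baseM; first exact: in_base_tofrac.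
by apply: cx; exists i, a.
Qed.

Lemma content_colon_base f r : content_colon f r%:F.
Proof. by move=> z _; rewrite -tofracM; apply: in_base_tofrac. Qed.

(** Since [A_f] lies in [R], its colon always contains [R]; its v-closure is [R] exactly when the
    colon is no larger. *)
Lemma NvP f : Nv Rg f <-> f != 0 /\ forall x, content_colon f x -> in_base x.
Proof.
split=> -[f0 hf]; split=> // x.
  move=> /colon_Acont cx; have /hf cl : in_base 1 by exists 1; rewrite tofrac1.
  by have := cl x cx; rewrite mul1r.
split=> [cl|[r ->] y /colon_Acont/hf[s ->]]; last by exists (r * s); rewrite tofracM.
have /cl : colon (Acont Rg f) 1 by apply/colon_Acont; rewrite -tofrac1; apply: content_colon_base.
by rewrite mulr1.
Qed.

Lemma content_colon_coef f x i : content_colon f x -> in_base (x * (f`_i)%:F).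
Proof.
move=> cx; have [s [g [_ fE cg _]]] := comp_decomposition f`_i; rewrite fE.
rewrite rmorph_sum big_distrr /=; apply: in_base_sum => a as_ _.
by apply: cx; exists i, a; apply: cg.
Qed.

Lemma content_neq0 f : f != 0 -> exists2 z, content_elt f z & z != 0.
Proof.
rewrite -lead_coef_eq0 => /comp_neq0[a [z [fz z0]]].
by exists z => //; exists (size f).-1, a.
Qed.

Lemma content_graded f z : content_elt f z -> exists a, Rg a z.
Proof. by move=> [i [a /is_comp_graded]]; exists a. Qed.

(** * Dedekind-Mertens for contents of polynomials *)

(** The last clause exempts 0, which is a component in every degree off the support. *)
Definition is_terms (s : seq ((G * nat) * R)) (f : {poly R}) : Prop :=
  [/\ f = \sum_(p <- s) p.2 *: 'X^(p.1.2),
      forall p, p \in s -> is_comp Rg f`_(p.1.2) p.1.1 p.2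
    & forall z, content_elt f z -> z != 0 -> z \in map snd s].

Lemma terms_exist (le : G * nat -> G * nat -> Prop) f :
  pure_order le -> (forall x y, le x y \/ le y x) ->
  exists s, is_terms s f /\ pairwise (key_gt le) s.
Proof.
move=> [rf asym tr _ _] tle.
have [S hS] := choice (fun i => comp_decomposition f`_i).
have [c hc] := choice hS.
pose s0 : seq ((G * nat) * R) := [seq ((a, i), c i a) | i <- iota 0 (size f), a <- S i].
have s0E p : p \in s0 -> p.1.1 \in S p.1.2 /\ p.2 = c p.1.2 p.1.1.
  by case/allpairsPdep => i [a [_ aS ->]].
pose r := [rel p q : (G * nat) * R | `[< le q.1 p.1 >]].
have rtr : transitive r.
  by move=> y x z /asboolP yx /asboolP zy; apply/asboolP; apply: tr zy yx.
have rtot : total r.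
  by move=> x y; apply/orP; case: (tle x.1 y.1) => h; [right|left]; apply/asboolP.
exists (sort r s0); split; first split.
- rewrite (perm_big s0) /=; last by rewrite perm_sort.
  rewrite big_allpairs_dep /= -[LHS]coefK poly_def.
  rewrite -(big_mkord xpredT (fun i => f`_i *: 'X^i)) /index_iota subn0.
  apply: eq_bigr => i _; have [_ -> _ _] := hc i; rewrite scaler_suml.
  by [].
- move=> p; rewrite mem_sort => /s0E[pS ->].
  by have [_ _ h _] := hc p.1.2; apply: h.
- move=> z [i [a fz]] z0; have [_ _ _ /(_ a z fz z0)[aS ->]] := hc i.
  have li : (i < size f)%N.
    rewrite ltnNge; apply: contra_neqN z0 => le_i.
    by move: fz; rewrite nth_default // => /is_comp_unique; apply; apply: is_comp0.
  apply/mapP; exists ((a, i), c i a) => //; rewrite mem_sort.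
  by apply/allpairsPdep; exists i, a; rewrite mem_iota.
(* Sorting gives a weakly decreasing list; distinct degrees make it strictly decreasing. *)
have : pairwise [rel p q : (G * nat) * R | r p q && (p.1 != q.1)] (sort r s0).
  rewrite pairwise_relI -sorted_pairwise // sort_sorted //=.
  rewrite -(pairwise_map fst (fun p q => p != q)) -uniq_pairwise.
  rewrite (perm_uniq (perm_map _ (permEl (perm_sort _ _)))).
  rewrite map_allpairs; apply: allpairs_uniq_dep; rewrite ?iota_uniq //.
    by move=> i _; case: (hc i).
  by move=> [i a] [j b] _ _ /= [-> ->].
apply: sub_pairwise => p q /= /andP[/asboolP qp npq].
by apply/asboolPn => pq; case/eqP: npq; apply: asym.
Qed.

(** Coefficients of the formal product thus belong to the content of [f * g], so [dedekind_mertens]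
    applies to contents. *)
Lemma is_comp_conv s t f g d :
  is_terms s f -> is_terms t g -> is_comp Rg (f * g)`_(d.2) d.1 (conv s t d).
Proof.
move=> [fE cf _] [gE cg _].
pose l := [seq pq <- [seq (p, q) | p <- s, q <- t] | pq.1.1.2 + pq.2.1.2 == d.2].
have lE pq : pq \in l -> pq.1 \in s /\ pq.2 \in t.
  by rewrite mem_filter => /andP[_ /allpairsP[x [xs xt ->]]].
have -> : (f * g)`_(d.2) = \sum_(pq <- l) pq.1.2 * pq.2.2.
  rewrite fE gE big_distrl coef_sum big_filter [RHS]big_mkcond big_allpairs.
  apply: eq_bigr => p _; rewrite big_distrr coef_sum; apply: eq_bigr => q _ /=.
  rewrite -scalerAl -scalerAr scalerA -exprD coefZ coefXn eq_sym.
  by case: eqP; rewrite ?mulr1 ?mulr0.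
have -> : conv s t d = \sum_(pq <- l | pq.1.1.1 + pq.2.1.1 == d.1) pq.1.2 * pq.2.2.
  rewrite /conv big_filter_cond [RHS]big_mkcond big_allpairs.
  apply: eq_bigr => p _; rewrite [LHS]big_mkcond; apply: eq_bigr => q _ /=.
  by case: d {l lE} => a i /=; rewrite xpair_eqE andbC.
apply: is_comp_sum => pq /lE[/cf/is_comp_graded hp /cg/is_comp_graded hq].
exact: gradedM.
Qed.

Lemma degree_cancellative_torsionfree : cancellative_torsionfree (G * nat)%type.
Proof.
have [canc tf] := hG; split=> [[a i] [b j] [c k] [/canc -> /addnI ->] //|].
move=> n [a i] [b j] n0 e; congr (_, _).
  by apply: (tf n) => //; have := congr1 fst e; rewrite !raddfMn.
have : i *+ n = j *+ n by have := congr1 snd e; rewrite !raddfMn.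
have natE k m : k *+ m = (m * k)%N by elim: m => // m IH; rewrite mulrS IH mulSn.
by rewrite !natE => /eqP; rewrite eqn_pmul2l // => /eqP.
Qed.

(* [R[X]] is graded by [G * nat], and its homogeneous elements are monomials
   with homogeneous coefficients. *)
Lemma content_dedekind_mertens f g : exists m, forall L : R -> Prop,
  additive_pred L ->
  (forall u h, size u = m -> (forall x, x \in u -> content_elt f x) ->
     content_elt (f * g) h -> L (\prod_(x <- u) x * h)) ->
  forall u w, size u = m.+1 -> (forall x, x \in u -> content_elt f x) ->
    content_elt g w -> L (\prod_(x <- u) x * w).
Proof.
have [le [ole tle]] := total_pure_order degree_cancellative_torsionfree.
have [s [hs ps]] := terms_exist f ole tle.
have [t [ht pt]] := terms_exist g ole tle.
exists (size t) => L aL HL u w su uf gw.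
have [fE cf fz] := hs; have [gE cg gz] := ht.
(* Term lists may omit zero components, so zero factors are treated apart. *)
have [w0|w0] := eqVneq w 0; first by rewrite w0 mulr0; case: aL.
have [z0|z0] := boolP (0 \in u).
  by rewrite (perm_big _ (perm_to_rem z0)) big_cons /= !mul0r; case: aL.
have /mapP[q qt ->] := gz w gw w0.
apply: (dedekind_mertens ole tle ps pt (leqnSn _) aL) => //; last first.
  by move=> x xu; apply: fz; [apply: uf|apply: contraNneq z0 => <-].
move=> v d sv vs; apply: HL => // [x /vs/mapP[p ps' ->]|].
  by exists p.1.2, p.1.1; apply: cf.
by exists d.2, d.1; apply: is_comp_conv.
Qed.

Lemma additive_in_base x : additive_pred (fun r => in_base (x * r%:F)).
Proof.
have [b0 _ bB _] := in_base_subring.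
by split=> [|r s]; rewrite ?tofrac0 ?mulr0 // tofracB mulrBr; apply: bB.
Qed.

(** * The ring [NA(R,v)] *)

(** If [x] carries c(fg) into [R], Dedekind-Mertens shows that it carries c(f)^(m+1) c(g) into [R];
    then c(g) is removed by [hg], and the factors c(f) one at a time by [hf]. *)
Lemma NvM f g : Nv Rg f -> Nv Rg g -> Nv Rg (f * g).
Proof.
move=> /NvP[f0 hf] /NvP[g0 hg]; apply/NvP; split; first exact: mulf_neq0.
move=> x cx; have [m hm] := content_dedekind_mertens f g.
have {hm} : forall u : seq R, size u = m.+1 -> (forall y, y \in u -> content_elt f y) ->
    in_base (x * (\prod_(y <- u) y)%:F).
  move=> u su uf; apply: hg => w gw; rewrite -mulrA -tofracM.
  apply: (hm _ (additive_in_base x)) => // v h sv vf fgh.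
  by rewrite tofracM mulrCA; apply: in_baseM; [apply: in_base_tofrac|apply: cx].
elim: (m.+1) x {cx} => [|k IH] x hx.
  by have := hx [::] erefl; rewrite big_nil tofrac1 mulr1; apply.
apply: IH => u su uf; apply: hf => w fw; rewrite -mulrA -tofracM mulrC.
have := hx (w :: u); rewrite big_cons mulrC [w * _]mulrC; apply; first by rewrite /= su.
by move=> y; rewrite in_cons => /predU1P[->//|/uf].
Qed.

Lemma Nv1 : Nv Rg 1.
Proof.
apply/NvP; split=> [|x /(content_colon_coef 0)]; first exact: oner_neq0.
by rewrite coef1 tofrac1 mulr1.
Qed.

Lemma NA_subring : is_subring (NA Rg).
Proof.
have Nv0 f : Nv Rg f -> f%:F != 0 by rewrite tofrac_eq0 => -[].
split.
- by exists 0, 1; rewrite tofrac0 mul0r; split; first exact: Nv1.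
- by exists 1, 1; rewrite tofrac1 divr1; split; first exact: Nv1.
- move=> _ _ [g [f [nf ->]]] [g' [f' [nf' ->]]].
  exists (g * f' - g' * f), (f * f'); split; first exact: NvM.
  by rewrite -mulNr addf_div ?Nv0 // tofracB !tofracM mulNr.
- move=> _ _ [g [f [nf ->]]] [g' [f' [nf' ->]]].
  exists (g * g'), (f * f'); split; first exact: NvM.
  by rewrite !tofracM mulf_div.
Qed.

Lemma NA_tofrac p : NA Rg p%:F.
Proof. by exists p, 1; rewrite tofrac1 divr1; split; first exact: Nv1. Qed.

Lemma tofrac_neq0 (D : idomainType) (d : D) : d != 0 -> d%:F != 0.
Proof. by rewrite tofrac_eq0. Qed.

(** From [a f = b g] with [a] and [b] homogeneous, [a / b] carries the content of [f] into [R],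
    hence lies in [R]. *)
Lemma NA_homogeneous_div a b al be :
  Rg al a -> Rg be b -> b != 0 -> NA Rg ((a%:P)%:F / (b%:P)%:F) ->
  in_base (a%:F / b%:F).
Proof.
move=> ha hb b0 [g [f [/NvP[f0 nf] /eqP]]].
rewrite eqr_div ?tofrac_neq0 ?polyC_eq0 // -!tofracM tofrac_eq => /eqP e.
apply: nf => z [i [d fz]].
have [|u zE] := comp_dvd_cancel (u := g`_i) ha hb fz.
  by have := congr1 (fun p : {poly R} => p`_i) e; rewrite coefCM coefMC mulrC [g`_i * _]mulrC.
exists u; apply: (mulIf (tofrac_neq0 b0)).
by rewrite mulrAC divfK ?tofrac_neq0 // -!tofracM mulrC zE mulrC.
Qed.

(** * Extended ideals and descent from [NA(R,v)] to [R] *)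

Definition NA_ext (I : R -> Prop) (z : {fraction {poly R}}) : Prop :=
  exists g f : {poly R}, [/\ forall i, I g`_i, Nv Rg f & z = g%:F / f%:F].

Lemma NA_ext_ideal I : ideal_R I -> is_ideal (NA Rg) (NA_ext I).
Proof.
move=> [I0 ID IM].
have Nv0 f : Nv Rg f -> f%:F != 0 by rewrite tofrac_eq0 => -[].
have IMp (p g : {poly R}) : (forall i, I g`_i) -> forall i, I (p * g)`_i.
  by move=> Ig i; rewrite coefM; apply: (big_ind I) => // j _; apply: IM.
split.
- by move=> _ [g [f [_ nf ->]]]; exists g, f.
- exists 0, 1; rewrite tofrac0 mul0r; split=> //; last exact: Nv1.
  by move=> i; rewrite coef0.
- move=> _ _ [g [f [Ig nf ->]]] [g' [f' [Ig' nf' ->]]].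
  exists (f' * g + f * g'), (f * f'); split; last 1 first.
  + by rewrite addf_div ?Nv0 // tofracD !tofracM ![f'%:F * _]mulrC [f%:F * g'%:F]mulrC.
  + by move=> i; rewrite coefD; apply: ID; apply: IMp.
  + exact: NvM.
- move=> _ _ [p [q [nq ->]]] [g [f [Ig nf ->]]].
  exists (p * g), (q * f); split; [exact: IMp|exact: NvM|].
  by rewrite !tofracM mulf_div.
Qed.

(** Here [r f = g] has coefficients in [I], so [r c(f)] lies in [I]; for [y] in [(R : I)], [y r]
    then carries c(f) into [R], hence lies in [R]. *)
Lemma NA_ext_v_ideal I a r :
  homogeneous_ideal Rg I -> v_ideal I -> Rg a r -> NA_ext I (r%:P)%:F -> I r.
Proof.
move=> [[I0 ID IM] hI] vI ra [g [f [Ig nf /eqP]]].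
have /NvP[f0 fN] := nf.
rewrite -[X in X == _]divr1 eqr_div ?oner_neq0 ?tofrac_neq0 // mulr1.
rewrite -tofracM tofrac_eq => /eqP e.
suff /vI[y [Iy /eqP]] : vclos (fun y => exists r, I r /\ y = r%:F) r%:F.
  by rewrite tofrac_eq => /eqP ->.
move=> y cy; rewrite mulrC; apply: fN => z [i [b fz]].
rewrite -mulrA -tofracM; apply: cy; exists (r * z); split=> //.
apply: (hI g`_i (b + a)) => //.
have -> : g`_i = f`_i * r by rewrite -e coefCM mulrC.
by rewrite [r * z]mulrC; apply: is_comp_mulr.
Qed.

Lemma Dedekind_graded_Krull : is_Dedekind (NA Rg) -> graded_Krull Rg.
Proof.
move=> [rS nS iS _]; split.
- move=> x [a [b [al [be [ha hb b0 xE]]]]] [c [c0 hc]].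
  rewrite xE; apply: (NA_homogeneous_div ha hb b0).
  have b0' : (b%:P)%:F != 0 :> {fraction {poly R}} by rewrite tofrac_neq0 ?polyC_eq0.
  apply: (@Dedekind_completely_integrally_closed _ _ (c%:P)%:F _ rS nS iS).
  + exists (a%:P)%:F, (b%:P)%:F; split=> //; apply: NA_tofrac.
  + by rewrite tofrac_neq0 ?polyC_eq0.
  move=> n; have [->|n0] := posnP n; first by rewrite expr0 mulr1; apply: NA_tofrac.
  have [r rE] := hc n n0.
  suff -> : (c%:P)%:F * ((a%:P)%:F / (b%:P)%:F) ^+ n = (r%:P)%:F by apply: NA_tofrac.
  apply: (mulIf (expf_neq0 n b0')); rewrite expr_div_n mulrA (divfK (expf_neq0 n b0')).
  have bn0 := expf_neq0 n (tofrac_neq0 b0).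
  have : c%:F * a%:F ^+ n = r%:F * b%:F ^+ n.
    by rewrite -rE xE expr_div_n mulrA divfK.
  rewrite -!tofracXn -!tofracM => /eqP; rewrite tofrac_eq => /eqP e.
  by congr (_ %:F); rewrite -!polyC_exp -!polyCM e.
- move=> I hI incI.
  have mono n k x : (n <= k)%N -> I n x -> I k x.
    by move=> /subnK <-; elim: (k - n)%N => // m IH /IH; rewrite addSn; apply: incI.
  pose U r := exists n, I n r.
  have idU : ideal_R U.
    split.
    - by exists 0%N; have [[[]]] := hI 0%N.
    - move=> x y [n nx] [k ky]; exists (n + k)%N.
      have [[[_ ID _] _] _] := hI (n + k)%N.
      by apply: ID; [apply: mono nx; apply: leq_addr|apply: mono ky; apply: leq_addl].
    - by move=> s x [n nx]; exists n; have [[[_ _ IM] _] _] := hI n; apply: IM.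
  have extU z : NA_ext U z -> exists n, NA_ext (I n) z.
    move=> [g [f [Ug nf ->]]]; have [n ng] := choice Ug.
    exists (\max_(i < size g) n i), g, f; split=> // i.
    have [li|li] := ltnP i (size g).
      by apply: mono (ng i); apply: (leq_bigmax (Ordinal li)).
    by rewrite nth_default //; have [[[]]] := hI (\max_(i < size g) n i).
  (* The largest index needed by finitely many generators of the extension of [U] is where the chain
     stops. *)
  have [k [e [Ue eU]]] := nS _ (NA_ext_ideal idU).
  have [n ne] := choice (fun i => extU _ (Ue i)).
  exists (\max_i n i) => m le_m x; split; last exact: mono.
  have [homN vN] := hI (\max_i n i); set N := \max_i n i in le_m homN vN *.
  have [_ N0 ND NM] := NA_ext_ideal homN.1.
  have hx a y : Rg a y -> I m y -> I N y.
    move=> ay my; apply: (NA_ext_v_ideal homN vN ay).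
    have /eU[r [Sr ->]] : NA_ext U (y%:P)%:F.
      exists y%:P, 1; rewrite tofrac1 divr1; split=> //; last exact: Nv1.
      move=> i; rewrite coefC; case: eqP => _; first by exists m.
      by case: idU.
    apply: (big_ind (NA_ext (I N))) => // i _; apply: NM => //.
    have [g [f [Ig nf ->]]] := ne i; exists g, f; split=> // j.
    by apply: mono (Ig j); apply: leq_bigmax.
  (* Only homogeneous elements descend, so [x] is split into components, which stay in [I m]. *)
  move=> mx; have [s [c [_ xE xc _]]] := comp_decomposition x.
  have [[_ hm] _] := hI m; have [[I0 ID IM] _] := homN.
  rewrite xE big_seq; apply: (big_ind (I N)) => // a as_.
  by apply: (hx a); [apply: is_comp_graded (xc a as_)|apply: hm mx (xc a as_)].
Qed.

(** * Homogeneous fractions, v-closures and v-inverses of contents *)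

Definition homogeneous_fraction (x : K) : Prop :=
  exists (a b : R) (al be : G), [/\ Rg al a, Rg be b, b != 0 & x = a%:F / b%:F].

Lemma homogeneous_fractionM x y :
  homogeneous_fraction x -> homogeneous_fraction y -> homogeneous_fraction (x * y).
Proof.
move=> [a [b [al [be [ha hb b0 ->]]]]] [c [d [ga [de [hc hd d0 ->]]]]].
exists (a * c), (b * d), (al + ga), (be + de).
by split; [exact: gradedM|exact: gradedM|exact: mulf_neq0|rewrite !tofracM mulf_div].
Qed.

Lemma homogeneous_fraction_div a b al be : Rg al a -> Rg be b -> b != 0 ->
  homogeneous_fraction (a%:F / b%:F).
Proof. by move=> ha hb b0; exists a, b, al, be. Qed.

Lemma homogeneous_fraction_tofrac a al : Rg al a -> homogeneous_fraction a%:F.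
Proof.
move=> ha; have [be [b [/is_comp_graded hb b0]]] := comp_neq0 (oner_neq0 R).
exists (a * b), b, (al + be), be; split=> //; first exact: gradedM.
by rewrite tofracM mulfK ?tofrac_neq0.
Qed.

Lemma homogeneous_fraction_content f z : content_elt f z -> homogeneous_fraction z%:F.
Proof. by case/content_graded=> a; apply: homogeneous_fraction_tofrac. Qed.

(* The conductor of a set of homogeneous fractions is a homogeneous
   fractional ideal. *)
Lemma homogeneous_conductor (E : K -> Prop) u0 x :
  (forall u, E u -> homogeneous_fraction u) -> E u0 -> u0 != 0 ->
  (forall u, E u -> in_base (x * u)) ->
  exists s : seq K, x = \sum_(y <- s) y /\
    forall y, y \in s -> homogeneous_fraction y /\ forall u, E u -> in_base (y * u).
Proof.
move=> hE Eu0 u00 xE.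
have [a [b [al [be [ha hb b0 u0E]]]]] := hE _ Eu0.
have [r rE] := xE _ Eu0.
have a0 : a != 0.
  by apply: contraNneq u00 => a0; rewrite u0E a0 tofrac0 mul0r.
(* The element [u0] gives [x] a homogeneous denominator [a]; the summands are the components of
   [r * b] over [a]. *)
have xdE : x = (r * b)%:F / a%:F.
  rewrite tofracM -rE u0E mulrA divfK ?tofrac_neq0 // mulfK ?tofrac_neq0 //.
have [s [c [_ dE dc _]]] := comp_decomposition (r * b).
exists [seq (c i)%:F / a%:F | i <- s]; split.
  by rewrite xdE dE rmorph_sum big_distrl big_map.
move=> _ /mapP[i si ->]; split.
  exact: homogeneous_fraction_div (is_comp_graded (dc i si)) ha a0.
move=> u Eu; have [a' [b' [al' [be' [ha' hb' b'0 uE]]]]] := hE _ Eu.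
have [w wE] := xE _ Eu.
have [|v vE] := comp_dvd_cancel (u := w) ha' (gradedM ha hb') (dc i si).
  apply/eqP; rewrite -tofrac_eq !tofracM -tofracM.
  by rewrite -eqf_div_mul_div ?tofrac_neq0 // -xdE -uE wE.
exists v; apply/eqP; rewrite uE eqf_div_mul_div ?tofrac_neq0 //.
by rewrite -!tofracM vE.
Qed.

(* The trace on [R] of the v-closure of the content of [f]. *)
Definition content_v (f : {poly R}) (r : R) : Prop :=
  forall x, content_colon f x -> in_base (x * r%:F).

Lemma content_elt_v f z : content_elt f z -> content_v f z.
Proof. by move=> fz x; apply. Qed.

(** Reduces membership questions to homogeneous fractions, the elements to which the closure
    condition of [graded_Krull] applies. *)
Lemma content_conductor f x : f != 0 -> content_colon f x ->
  exists s : seq K, x = \sum_(y <- s) y /\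
    forall y, y \in s -> homogeneous_fraction y /\ content_colon f y.
Proof.
move=> f0 cx; have [z0 fz0 z00] := content_neq0 f0.
have [|||u [z [fz ->]]|s [xE sE]] := @homogeneous_conductor
    (fun u => exists z, content_elt f z /\ u = z%:F) z0%:F x.
- by move=> _ [z [fz ->]]; apply: homogeneous_fraction_content fz.
- by exists z0.
- by rewrite tofrac_neq0.
- exact: cx.
exists s; split=> // y ys; have [hy cy] := sE y ys.
by split=> // z fz; apply: cy; exists z.
Qed.

Lemma content_v_homogeneous_ideal f : f != 0 -> homogeneous_ideal Rg (content_v f).
Proof.
move=> f0; have [_ _ bD _ _] := subring_pred in_base_subring; split.
  split.
  - by move=> x _; rewrite tofrac0 mulr0; exists 0; rewrite tofrac0.
  - by move=> x y vx vy u cu; rewrite tofracD mulrDr; apply: bD; [apply: vx|apply: vy].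
  - move=> s x vx u cu; rewrite tofracM mulrCA.
    by apply: in_baseM; [apply: in_base_tofrac|apply: vx].
move=> r b y vr ry x cx; have [s [-> sE]] := content_conductor f0 cx.
rewrite big_distrl; apply: in_base_sum => t ts _ /=.
have [[a [d [al [de [ha hd d0 tE]]]]] ct] := sE t ts.
have [u uE] := vr t ct.
have [|v vE] := comp_dvd_cancel (u := u) ha hd ry.
  apply/eqP; rewrite -tofrac_eq !tofracM mulrC.
  by rewrite -eqf_div_mul ?tofrac_neq0 // -tE uE.
exists v; apply/eqP; rewrite tE eqf_div_mul ?tofrac_neq0 //.
by rewrite -!tofracM mulrC vE.
Qed.

(** The conductor of c(f) also carries [content_v f] into [R], and it contains 1, so the v-closure
    stays inside [R]. *)
Lemma content_v_v_ideal f : v_ideal (content_v f).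
Proof.
move=> x; split=> [cx|[r [vr ->]] y cy]; last by rewrite mulrC; apply: cy; exists r.
have fx y : content_colon f y -> in_base (x * y).
  by move=> cy; apply: cx => _ [r [vr ->]]; apply: vr.
have [|r xE] := fx 1; first by rewrite -tofrac1; apply: content_colon_base.
rewrite mulr1 in xE; exists r; split=> // y cy.
by rewrite mulrC -xE; apply: fx.
Qed.

(* For [n >= size f] the content of [f + X^n g] is the sum of the contents of
   [f] and [g], so a maximal [content_v f] absorbs every [g]. *)
Lemma maximal_content (P : {poly R} -> Prop) : graded_Krull Rg ->
  (forall f, P f -> f != 0) ->
  (forall f g, P f -> P g -> P (f + 'X^(size f) * g)) ->
  (exists f, P f) ->
  exists f, P f /\ forall g, P g -> forall z, content_elt g z -> content_v f z.
Proof.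
move=> [_ acc] P0 PD [f0 Pf0]; apply: contrapT => nmax.
have step (f : {f | P f}) : exists h : {h | P h},
    (forall r, content_v (sval f) r -> content_v (sval h) r) /\
    ~ (forall r, content_v (sval h) r -> content_v (sval f) r).
  case: f => f Pf; have [g Pg [z gz nz]] : exists2 g, P g &
      exists2 z, content_elt g z & ~ content_v f z.
    apply: contrapT => nex; apply: nmax; exists f; split=> // g Pg z gz.
    by apply: contrapT => nz; apply: nex; exists g => //; exists z.
  exists (exist _ _ (PD f g Pf Pg)) => /=; split.
    move=> r vr x cx; apply: vr => w [i [a fw]]; apply: cx.
    (* A zero [w] may come from a degree where [g] interferes, so it is relocated past the end of
       the sum. *)
    have [w0|w0] := eqVneq w 0.
      by exists (size (f + 'X^(size f) * g)), a; rewrite w0 nth_default //; apply: is_comp0.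
    exists i, a; rewrite coefD coefXnM; case: ltnP => [_|li]; first by rewrite addr0.
    case/eqP: w0; move: fw; rewrite nth_default // => /is_comp_unique; apply.
    exact: is_comp0.
  move=> sub; apply: nz; apply: sub; apply: content_elt_v.
  have [i [a gi]] := gz; exists (size f + i)%N, a.
  by rewrite coef_addXn.
have [next hnext] := choice step.
pose F n := iter n next (exist _ f0 Pf0).
have [|n x|N hN] := acc (fun n => content_v (sval (F n))).
- move=> n; split; last exact: content_v_v_ideal.
  by apply: content_v_homogeneous_ideal; apply: P0; case: (F n).
- exact: (hnext (F n)).1.
apply: (hnext (F N)).2 => r; exact: (hN N.+1 (leqnSn N) r).1.
Qed.

(* If [y] is a product of [x] with an element of each content, then
   Dedekind-Mertens gives [y c(f)^m <= c(f)^m], so [y] is almost integral. *)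
Lemma graded_Krull_gauss f g x : graded_Krull Rg -> f != 0 ->
  homogeneous_fraction x ->
  (forall h, content_elt (f * g) h -> in_base (x * h%:F)) ->
  forall z w, content_elt f z -> content_elt g w -> in_base (x * (z * w)%:F).
Proof.
move=> [cic _] f0 hx xfg z w fz gw; move yE : (x * _) => y.
have hy : homogeneous_fraction y.
  rewrite -yE tofracM; apply: homogeneous_fractionM hx _.
  by apply: homogeneous_fractionM;
    [apply: homogeneous_fraction_content fz|apply: homogeneous_fraction_content gw].
have [m hm] := content_dedekind_mertens f g.
have pow n u : size u = m -> (forall v, v \in u -> content_elt f v) ->
    in_base (y ^+ n * (\prod_(v <- u) v)%:F).
  elim: n u => [|n IH] u su uf; first by rewrite mul1r; apply: in_base_tofrac.
  (* One [y] is split as [x * z * w], giving the [m + 1] factors from c(f) and the one from c(g)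
     that Dedekind-Mertens needs. *)
  have -> : y ^+ n.+1 * (\prod_(v <- u) v)%:F =
      (y ^+ n * x) * (\prod_(v <- z :: u) v * w)%:F.
    rewrite big_cons exprSr -!mulrA; congr (_ * _).
    by rewrite -yE -mulrA -tofracM; congr (_ * (_ %:F)); ring.
  apply: (hm _ (additive_in_base _)) => //; last 2 first.
  - by rewrite /= su.
  - by move=> v; rewrite in_cons => /predU1P[->|/uf].
  move=> v h sv vf fgh; rewrite tofracM mulrACA.
  by apply: in_baseM; [apply: IH|apply: xfg].
have [z0 fz0 z00] := content_neq0 f0.
apply: cic => //; exists (\prod_(v <- nseq m z0) v); split.
  by rewrite big_nseq -Monoid.iteropE -/(GRing.exp _ _) expf_neq0.
move=> n _; rewrite mulrC; apply: pow; first by rewrite size_nseq.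
by move=> v /nseqP[->].
Qed.

(* [k / c] generates the fractional v-ideal [(R : c(f))], and the contents of
   [f] and [k / c] are v-inverse to each other. *)
Lemma content_v_inverse f : graded_Krull Rg -> f != 0 ->
  exists (k : {poly R}) (c : R) (ga : G),
    [/\ k != 0, Rg ga c, c != 0,
        forall z w, content_elt f z -> content_elt k w -> exists r, w * z = c * r
      & forall x : K, (forall z w, content_elt f z -> content_elt k w ->
          in_base (x * ((z * w)%:F / c%:F))) -> in_base x].
Proof.
move=> krull f0; have [cic _] := krull.
have [c fc c0] := content_neq0 f0; have [ga hc] := content_graded fc.
(* This is [c] times [(R : c(f))], an ideal of [R] because [c] is in the content of [f]. *)
pose J r := forall z, content_elt f z -> exists s, r * z = c * s.
have J_comp r b y : J r -> is_comp Rg r b y -> J y.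
  move=> Jr ry z fz; have [s rz] := Jr z fz; have [a hz] := content_graded fz.
  exact: comp_dvd_cancel hz hc ry rz.
pose P k := k != 0 /\ forall w, content_elt k w -> J w.
have [|||k [[k0 Jk] kmax]] := @maximal_content P krull.
- by move=> k [].
- move=> k l [k0 Jk] [l0 Jl]; split.
    exact: addXn_neq0.
  move=> w [i [a]]; rewrite coefD coefXnM; case: ltnP => li.
    by rewrite addr0 => kw; apply: Jk; exists i, a.
  by rewrite nth_default // add0r => lw; apply: Jl; exists (i - size k)%N, a.
- exists c%:P; split; first by rewrite polyC_eq0.
  have Jc : J c by move=> z _; exists z.
  move=> w [i [a]]; rewrite coefC; case: eqP => _; first exact: J_comp.
  by move=> /is_comp_unique/(_ (is_comp0 a)) -> z _; exists 0; rewrite mul0r mulr0.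
(* Maximality of [k] is applied to constant polynomials. *)
have J_v r : J r -> content_v k r.
  move=> Jr; have [-> x _|r0] := eqVneq r 0.
    by rewrite tofrac0 mulr0 -tofrac0; apply: in_base_tofrac.
  have Pr : P r%:P.
    split; first by rewrite polyC_eq0.
    move=> w [i [a]]; rewrite coefC; case: eqP => _; first exact: J_comp.
    by move=> /is_comp_unique/(_ (is_comp0 a)) -> z _; exists 0; rewrite mul0r mulr0.
  have [[V0 VD _] _] := content_v_homogeneous_ideal k0.
  have [s [d [_ rE rd _]]] := comp_decomposition r.
  rewrite rE big_seq; apply: (big_ind (content_v k)) => // a as_.
  by apply: (kmax _ Pr); exists 0%N, a; rewrite coefC; apply: rd.
exists k, c, ga; split=> //; first by move=> z w fz kw; apply: Jk.
have homogeneous_case x : homogeneous_fraction x ->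
    (forall z w, content_elt f z -> content_elt k w ->
      in_base (x * ((z * w)%:F / c%:F))) -> in_base x.
  move=> hx xfk; apply: cic => //; exists c; split=> // n _.
  suff [r [-> _]] : exists r, c%:F * x ^+ n = r%:F /\ J r by exists r.
  (* The powers [c x^n] stay in [J]: for [z] in c(f), [x z / c] carries c(k) into [R], hence also
     [r], which is in the v-closure of c(k). *)
  elim: n => [|n [r [rE Jr]]].
    by exists c; rewrite mulr1; split=> // z _; exists z.
  have Jx z : content_elt f z -> in_base (x * z%:F / c%:F * r%:F).
    move=> fz; apply: (J_v r Jr) => w kw.
    have -> : x * z%:F / c%:F * w%:F = x * ((z * w)%:F / c%:F).
      by rewrite tofracM -!mulrA [_^-1 * _]mulrC.
    exact: xfk.
  have [s sE] := Jx c fc; rewrite mulfK ?tofrac_neq0 // in sE.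
  exists s; split; first by rewrite exprSr mulrA rE mulrC.
  move=> z fz; have [t tE] := Jx z fz; exists t.
  apply/eqP; rewrite -tofrac_eq !tofracM -sE mulrAC.
  by rewrite -eqf_div_mul ?tofrac_neq0 // tE.
move=> x xfk; have [w0 kw0 w00] := content_neq0 k0.
have [|||u [z [w [fz kw ->]]]|s [-> sE]] := @homogeneous_conductor
    (fun u => exists z w, [/\ content_elt f z, content_elt k w & u = (z * w)%:F / c%:F])
    ((c * w0)%:F / c%:F) x.
- move=> _ [z [w [fz kw ->]]].
  have [a hz] := content_graded fz; have [b hw] := content_graded kw.
  exact: homogeneous_fraction_div (gradedM hz hw) hc c0.
- by exists c, w0.
- by rewrite mulf_neq0 ?invr_eq0 ?tofrac_neq0 ?mulf_neq0.
- exact: xfk.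
apply: in_base_sum => y ys _; have [hy cy] := sE y ys.
by apply: homogeneous_case => // z w fz kw; apply: cy; exists z, w.
Qed.

(** * Divisibility in [NA(R,v)] and principality of ideals *)

Lemma content_colonZ p x c ga : Rg ga c -> c != 0 ->
  content_colon p x -> content_colon (c *: p) (x / c%:F).
Proof.
move=> hc c0 cx z [i [a]]; rewrite coefZ.
have [s [d [_ pE pd _]]] := comp_decomposition p`_i.
have := @is_comp_sum _ s (fun b => ga + b) (fun b => c * d b) a
  (fun b bs => gradedM hc (is_comp_graded (pd b bs))).
rewrite -!big_distrr /= -pE => /is_comp_unique h /h <-.
rewrite tofracM mulrA divfK ?tofrac_neq0 // rmorph_sum big_distrr.
by apply: in_base_sum => b bs _; apply: cx; exists i, b; apply: pd.
Qed.

(** Dividing by [c] keeps everything in [R[X]]: [f k = c p] and [g k = c q], so [g / f = q / p], and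
    [p] is shown to lie in [N(v)]. *)
Lemma graded_Krull_dvd f g : graded_Krull Rg -> f != 0 ->
  (forall z, content_elt g z -> content_v f z) -> NA Rg (g%:F / f%:F).
Proof.
move=> krull f0 gf; have [k [c [ga [k0 hc c0 fk xfk]]]] := content_v_inverse krull f0.
have c0F := tofrac_neq0 c0.
have coef_dvd (h : {poly R}) : (forall z w, content_elt h z -> content_elt k w ->
    exists r, z * w = c * r) -> exists p, h * k = c *: p.
  move=> hhk; have coefhk i j : exists r, h`_i * k`_j = c * r.
    have : in_base ((k`_j)%:F / c%:F * (h`_i)%:F).
      apply: content_colon_coef => z hz; rewrite mulrC mulrCA mulrC.
      apply: content_colon_coef => w kw; have [r rE] := hhk z w hz kw.
      by exists r; apply/eqP; rewrite eqf_div_mul // -!tofracM rE.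
    case=> r rE; exists r; apply/eqP; rewrite -tofrac_eq !tofracM.
    by rewrite mulrC -eqf_div_mul // rE.
  have : forall i, exists r, (h * k)`_i = c * r.
    move=> i; rewrite coefM; apply: (big_ind (fun y => exists r, y = c * r)) => //.
    - by exists 0; rewrite mulr0.
    - by move=> _ _ [r ->] [s ->]; exists (r + s); rewrite mulrDr.
  move=> /choice[d dE]; exists (\poly_(i < size (h * k)) d i).
  apply/polyP => i; rewrite coefZ coef_poly.
  case: ltnP => [_|li]; first exact: dE.
  by rewrite nth_default // mulr0.
have [|p pE] := coef_dvd f; first by move=> z w fz kw; rewrite mulrC; apply: fk.
have [|q qE] := coef_dvd g.
  move=> z w gz kw; have [|r rE] := gf z gz (w%:F / c%:F).
    move=> y fy; have [r rE] := fk y w fy kw.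
    by exists r; apply/eqP; rewrite eqf_div_mul // -!tofracM rE.
  exists r; apply/eqP; rewrite -tofrac_eq !tofracM.
  by rewrite mulrC -eqf_div_mul // rE.
have p0 : p != 0.
  by apply: contraNneq (mulf_neq0 f0 k0) => p0; rewrite pE p0 scaler0.
exists q, p; split; last first.
  apply/eqP; rewrite eqr_div ?tofrac_neq0 // -!tofracM tofrac_eq.
  have cP0 : c%:P != 0 by rewrite polyC_eq0.
  apply/eqP/(mulfI cP0).
  have -> : c%:P * (g * p) = g * (f * k) by rewrite pE -mul_polyC; ring.
  have -> : c%:P * (q * f) = (g * k) * f by rewrite qE -mul_polyC; ring.
  by ring.
apply/NvP; split=> // x cx.
have [s [-> sE]] := content_conductor p0 cx.
apply: in_base_sum => y ys _; have [hy cy] := sE y ys.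
(* As [y] carries c(p) into [R], [y / c] carries c(fk) into [R]; [graded_Krull_gauss] replaces c(fk)
   by products from c(f) and c(k). *)
apply: xfk => z w fz kw.
have -> : y * ((z * w)%:F / c%:F) = y / c%:F * (z * w)%:F by rewrite mulrA mulrAC.
apply: (graded_Krull_gauss krull f0 _ _ fz kw) => [|h].
  have [a [b [al [be [ha hb b0 ->]]]]] := hy.
  rewrite -mulrA -invfM -tofracM.
  exact: homogeneous_fraction_div ha (gradedM hb hc) (mulf_neq0 b0 c0).
by rewrite pE; apply: (content_colonZ hc c0 cy).
Qed.

Lemma graded_Krull_PID : graded_Krull Rg -> is_PID (NA Rg).
Proof.
move=> krull; split; first exact: NA_subring.
move=> I [Isub I0 ID IM].
have [[x [Ix x0]]|triv] := pselect (exists x, I x /\ x != 0); last first.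
  exists 0; split=> [|x]; first by have [] := NA_subring.
  split=> [Ix|[s [_ ->]]]; last by rewrite mulr0.
  exists 0; rewrite mulr0; split; first by have [] := NA_subring.
  by apply: contrapT => /eqP x0; apply: triv; exists x.
(* Denominators lie in [NA(R,v)], so an ideal contains the numerators of its elements and is
   governed by its polynomials. *)
have numer g f : Nv Rg f -> I (g%:F / f%:F) -> I g%:F.
  move=> [f0 _] Igf.
  have := IM _ _ (NA_tofrac f) Igf.
  by rewrite mulrC divfK ?tofrac_neq0.
pose P g := g != 0 /\ I g%:F.
have [|||f [[f0 If] fmax]] := @maximal_content P krull.
- by move=> g [].
- move=> g h [g0 Ig] [h0 Ih]; split.
    exact: addXn_neq0.
  by rewrite tofracD tofracM; apply: ID => //; apply: IM => //; apply: NA_tofrac.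
- have [g [f [nf xE]]] := Isub x Ix; exists g; split; last by apply: (numer g f); rewrite -?xE.
  by apply: contraNneq x0 => g0; rewrite xE g0 tofrac0 mul0r.
exists f%:F; split=> [|y]; first exact: NA_tofrac.
split=> [Iy|[s [Ss ->]]]; last exact: IM.
have [g [h [nh yE]]] := Isub y Iy.
exists (y / f%:F); split; last by rewrite divfK ?tofrac_neq0.
have Ig : I g%:F by apply: (numer g h); rewrite -?yE.
have [_ _ _ SM] := NA_subring.
have -> : y / f%:F = 1 / h%:F * (g%:F / f%:F) by rewrite yE mul1r mulrA [_^-1 * _]mulrC.
apply: SM; first by exists 1, h; rewrite tofrac1.
have [->|g0] := eqVneq g 0.
  by rewrite tofrac0 mul0r; have [] := NA_subring.
by apply: graded_Krull_dvd krull f0 _ => z gz; apply: (fmax g _ z gz); split.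
Qed.
End GradedDomain.

Theorem theorem3p11 (G : nmodType) (R : idomainType) (Rg : G -> R -> Prop)
  (hG : cancellative_torsionfree G) (hR : is_grading Rg) :
  (graded_Krull Rg <-> is_Dedekind (NA Rg)) /\
  (is_Dedekind (NA Rg) <-> is_PID (NA Rg)).
Proof.
have krull_pid := graded_Krull_PID hG hR.
have ded_krull := Dedekind_graded_Krull hG hR.
have pid_ded := @PID_Dedekind _ (NA Rg).
split; [split=> [krull|ded]|split=> [ded|pid]].
- exact/pid_ded/krull_pid.
- exact: ded_krull.
- exact/krull_pid/ded_krull.
- exact: pid_ded.
Qed.
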